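(* Let $(X,d,W,\eta)$ be a $UCW$-hyperbolic space, $C\subseteq X$ a convex subset and $T:C\to C$ a nonexpansive mapping. Assume that $(\lambda_n)_{n\in\mathbb{N}}$, $(s_n)_{n\in\mathbb{N}}$ are sequences in $[0,1]$ satisfying the following properties: (i) $\sum_{n=0}^\infty \lambda_n(1-\lambda_n)$ diverges with rate of divergence $\theta:\mathbb{N}\to\mathbb{N}$; (ii) $\limsup_{n\to\infty} s_n<1$, with $L,N_0\in\mathbb{N}$, $L\ge 1$, satisfying $s_n\le 1-\frac1L$ for all $n\ge N_0$; (iii) $\sum_{n=0}^\infty s_n(1-\lambda_n)$ converges with Cauchy modulus $\gamma$. Let $x\in C$ and $b>0$ be such that for every $\delta>0$ there is $y\in C$ with $d(x,y)\le b$ and $d(y,Ty)<\delta$. Let $(x_n)$ be the Ishikawa iteration starting with $x$. Then $\lim_{n\to\infty} d(x_n,Tx_n)=0$ and, moreover, $$\forall \varepsilon>0\ \forall n\ge \Phi(\varepsilon,\eta,b,N_0,L,\theta,\gamma)\quad d(x_n,Tx_n)<\varepsilon,$$ where $$\Phi(\varepsilon,\eta,b,N_0,L,\theta,\gamma)=\theta(P+\gamma_0+1+N_0),\qquad \gamma_0=\gamma\left(\frac{\varepsilon}{8b}\right),$$ $$P=\left\lceil \frac{L(b+1)}{\varepsilon\cdot\eta\left(b+1,\frac{\varepsilon}{L(b+1)}\right)}\right\rceil .$$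
   Context: $\mathbb{N}=\{0,1,2,\dots\}$. A $W$-hyperbolic space $(X,d,W)$ is a metric space $(X,d)$ with a map $W:X\times X\times[0,1]\to X$ such that for all $x,y,z,w\in X$ and $\lambda,\tilde\lambda\in[0,1]$: (W1) $d(z,W(x,y,\lambda))\le(1-\lambda)d(z,x)+\lambda d(z,y)$; (W2) $d(W(x,y,\lambda),W(x,y,\tilde\lambda))=|\lambda-\tilde\lambda|\,d(x,y)$; (W3) $W(x,y,\lambda)=W(y,x,1-\lambda)$; (W4) $d(W(x,z,\lambda),W(y,w,\lambda))\le(1-\lambda)d(x,y)+\lambda d(z,w)$. One writes $(1-\lambda)x\oplus\lambda y$ for $W(x,y,\lambda)$. A nonempty subset $C\subseteq X$ is convex if $(1-\lambda)x\oplus\lambda y\in C$ for all $x,y\in C$, $\lambda\in[0,1]$. A modulus of uniform convexity for $(X,d,W)$ is a map $\eta:(0,\infty)\times(0,2]\to(0,1]$ such that for all $r>0$, $\varepsilon\in(0,2]$, $a,x,y\in X$: if $d(x,a)\le r$, $d(y,a)\le r$ and $d(x,y)\ge\varepsilon r$, then $d(\frac12x\oplus\frac12y,a)\le(1-\eta(r,\varepsilon))r$. A $UCW$-hyperbolic space $(X,d,W,\eta)$ is a $W$-hyperbolic space with a modulus of uniform convexity $\eta$ that is nonincreasing in its first argument. Convention: whenever an expression $\eta(r,\varepsilon')$ with $\varepsilon'>2$ occurs, it is given an arbitrary value in $(0,1]$. $T:C\to C$ is nonexpansive if $d(Tx,Ty)\le d(x,y)$ for all $x,y\in C$. The Ishikawa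 iteration starting with $x\in C$ is $$x_0=x,\qquad x_{n+1}=(1-\lambda_n)x_n\oplus\lambda_nT\big((1-s_n)x_n\oplus s_nTx_n\big).$$ $\theta:\mathbb{N}\to\mathbb{N}$ is a rate of divergence of $\sum\lambda_n(1-\lambda_n)$ if $\sum_{k=0}^{\theta(n)}\lambda_k(1-\lambda_k)\ge n$ for all $n\in\mathbb{N}$. With $\alpha_n:=\sum_{i=0}^n s_i(1-\lambda_i)$, $\gamma:(0,\infty)\to\mathbb{N}$ is a Cauchy modulus of $\sum s_n(1-\lambda_n)$ if $\alpha_{\gamma(\varepsilon)+n}-\alpha_{\gamma(\varepsilon)}\le\varepsilon$ for all $\varepsilon>0$, $n\in\mathbb{N}$. *)

(* Defs.v *)
From mathcomp Require Import all_boot all_order all_algebra.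
From mathcomp Require Import all_classical all_reals all_analysis.

Set Implicit Arguments.
Unset Strict Implicit.
Unset Printing Implicit Defensive.

Import Order.TTheory GRing.Theory Num.Theory.
Import numFieldNormedType.Exports.

Local Open Scope classical_set_scope.
Local Open Scope ring_scope.

(* [W x y l] is the point written (1 - l) x (+) l y. The convexity mapping is
   a total function on [R], constrained only for parameters in [0, 1]. *)
Record is_Whyperbolic (R : realType) (X : metricType R)
    (W : X -> X -> R -> X) : Prop := {
  W1 : forall (x y z : X) (l : R), 0 <= l <= 1 ->
    mdist z (W x y l) <= (1 - l) * mdist z x + l * mdist z y ;
  W2 : forall (x y : X) (l l' : R), 0 <= l <= 1 -> 0 <= l' <= 1 ->
    mdist (W x y l) (W x y l') = `|l - l'| * mdist x y ;
  W3 : forall (x y : X) (l : R), 0 <= l <= 1 -> W x y l = W y x (1 - l) ;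
  W4 : forall (x y z w : X) (l : R), 0 <= l <= 1 ->
    mdist (W x z l) (W y w l) <= (1 - l) * mdist x y + l * mdist z w
}.

Definition is_convex (R : realType) (X : metricType R) (W : X -> X -> R -> X)
    (C : set X) : Prop :=
  C !=set0 /\
  forall (x y : X) (l : R), C x -> C y -> 0 <= l <= 1 -> C (W x y l).

(* A modulus is a map (0, oo) x (0, 2] -> (0, 1], represented by a total
   function on [R * R] constrained on that domain only. *)
Record is_modulus_of_uniform_convexity (R : realType) (X : metricType R)
    (W : X -> X -> R -> X) (eta : R -> R -> R) : Prop := {
  modulus_range : forall r e : R, 0 < r -> 0 < e <= 2 -> 0 < eta r e <= 1 ;
  modulus_convexity : forall (r e : R) (a x y : X), 0 < r -> 0 < e <= 2 ->
    mdist x a <= r -> mdist y a <= r -> e * r <= mdist x y ->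
    mdist (W x y 2^-1) a <= (1 - eta r e) * r
}.

Record is_UCWhyperbolic (R : realType) (X : metricType R)
    (W : X -> X -> R -> X) (eta : R -> R -> R) : Prop := {
  UCW_hyperbolic : is_Whyperbolic W ;
  UCW_modulus : is_modulus_of_uniform_convexity W eta ;
  UCW_nonincreasing : forall r r' e : R, 0 < r -> r <= r' -> 0 < e <= 2 ->
    eta r' e <= eta r e
}.

(* [eta r e] for [e > 2] lies outside the domain of a modulus; it may be
   any value in (0, 1]. *)
Definition out_of_range_convention (R : realType) (eta : R -> R -> R) : Prop :=
  forall r e : R, 0 < r -> 2 < e -> 0 < eta r e <= 1.

Definition nonexpansive_on (R : realType) (X : metricType R) (C : set X)
    (T : X -> X) : Prop :=
  forall x y : X, C x -> C y -> mdist (T x) (T y) <= mdist x y.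

Fixpoint ishikawa (R : realType) (X : metricType R) (W : X -> X -> R -> X)
    (T : X -> X) (lam s : nat -> R) (x : X) (n : nat) : X :=
  if n is m.+1 then
    let xm := ishikawa W T lam s x m in
    W xm (T (W xm (T xm) (s m))) (lam m)
  else x.

Definition rate_of_divergence (R : realType) (a : nat -> R)
    (theta : nat -> nat) : Prop :=
  forall n : nat, n%:R <= \sum_(0 <= k < (theta n).+1) a k.

Definition cauchy_modulus (R : realType) (a : nat -> R)
    (gamma : R -> nat) : Prop :=
  forall (e : R) (n : nat), 0 < e ->
    \sum_(0 <= i < (gamma e + n).+1) a i - \sum_(0 <= i < (gamma e).+1) a i
      <= e.

(* The ceiling is an integer; it is taken at a positive real in all uses, so
   [absz] only converts it to [nat]. *)
Definition P_bound (R : realType) (e : R) (eta : R -> R -> R) (b : R)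
    (L : nat) : nat :=
  absz (Num.ceil (L%:R * (b + 1) /
      (e * eta (b + 1) (e / (L%:R * (b + 1)))))).

Definition Phi (R : realType) (e : R) (eta : R -> R -> R) (b : R)
    (N0 L : nat) (theta : nat -> nat) (gamma : R -> nat) : nat :=
  theta (P_bound e eta b L + gamma (e / (8 * b))%R + 1 + N0)%N.

(* Main.v *)
Require Import Defs.
From mathcomp Require Import all_boot all_order all_algebra.
From mathcomp Require Import all_classical all_reals all_analysis.
From mathcomp Require Import ring lra zify.

Set Implicit Arguments.
Unset Strict Implicit.
Unset Printing Implicit Defensive.

Import Order.TTheory GRing.Theory Num.Theory.
Import numFieldNormedType.Exports.

Local Open Scope classical_set_scope.
Local Open Scope ring_scope.

(** The proof follows two quantities along the iteration: the residual
a_n = d(x_n, T x_n) and the distance rho_n = d(x_n, y) to an almost fixed point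
y with d(x, y) <= b and d(y, T y) as small as desired.

The residual is at most 2b, and one step multiplies it by at most
1 + 2 s_n (1 - lam_n) (step_residual).  From K = gamma(e/(8b)) + 1 + N0 on, the
sum of s_n (1 - lam_n) is at most e/(8b), so the residual can hardly grow: if
a_n >= e for some n >= Phi (whence e <= 2b), then a_m >= e / exp(1/2) >= 3e/5
for all K <= m <= n.

The distance rho_n is almost nonincreasing.  When x_m and T p_m, with p_m =
(1 - s_m) x_m (+) s_m T x_m, are at least e/L apart, uniform convexity
(uniform_convexity_W) makes rho drop by 2 lam_m (1 - lam_m) h rho_m, where
h = eta(b+1, e/(L(b+1))).  Since e <= a_n <= 2 rho_n up to an error that
vanishes with d(y, T y), rho_m is essentially at least e/2 for every m <= n, so
the drop is at least h e lam_m (1 - lam_m).  As rho decreases from at most b to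
at least e/2, the sum S of lam_m (1 - lam_m) over these steps satisfies
e/2 + h e S <= b (ishikawa_descent).

It remains to see that S is too large.  The rate of divergence gives a sum of
at least P + 1/2 over all steps K <= m < n (divergence_tail), and
h e P >= L (b+1).  One has d(x_m, T p_m) >= (1 - s_m) a_m (step_gap).  If L =
1, then s_m = 0 for m >= N0, the residual does not grow, and every step
qualifies. If L >= 2, a step with s_m <= 1/6 qualifies, because (1 - s_m) a_m
>= 5/6 * 3/5 * e = e/2 >= e/L.  The steps with s_m > 1/6 are negligible: over
them lam_m (1 - lam_m) <= 6 s_m (1 - lam_m), which sums to at most 6 e/(8b) <=
3/2, and this loss is paid for by the factor L >= 2 in P.  This use of the
Cauchy modulus, rather than of s_m <= 1 - 1/L at every step, is what allows the
constants of Phi: a_m >= e/2 and 1 - s_m >= 1/L alone would give only half of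
the gap e/L at which P evaluates the modulus eta. *)

(** * Uniform convexity for arbitrary convex combinations *)

Section UniformConvexity.
Context {R : realType} {X : metricType R}.
Context (W : X -> X -> R -> X) (eta : R -> R -> R).
Context (hW : is_Whyperbolic W) (hM : is_modulus_of_uniform_convexity W eta).

Lemma mdist_W_l (x y : X) (l : R) : 0 <= l <= 1 ->
  mdist x (W x y l) <= l * mdist x y.
Proof. by move=> hl; have := W1 hW x y x hl; rewrite mdistxx; lra. Qed.

Lemma mdist_W_r (x y : X) (l : R) : 0 <= l <= 1 ->
  mdist y (W x y l) <= (1 - l) * mdist x y.
Proof.
by move=> hl; have := W1 hW x y y hl; rewrite mdistxx (metric_sym y x); lra.
Qed.

(** Strict convexity: if two points divided the segment from x to y in the same
ratio, uniform convexity about x would put their midpoint strictly closer to x,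
against the triangle inequality through that midpoint. *)
Lemma between_unique (x y z z' : X) (l : R) :
  mdist x z <= l * mdist x y -> mdist y z <= (1 - l) * mdist x y ->
  mdist x z' <= l * mdist x y -> mdist y z' <= (1 - l) * mdist x y ->
  z = z'.
Proof.
move=> xz yz xz' yz'; apply/eqP/negPn; rewrite -mdist_gt0; apply/negP => zz'.
set r := l * mdist x y in xz xz'.
have zz'r : mdist z z' <= 2 * r.
  by have := metric_triangle z x z'; rewrite (metric_sym z x); lra.
have r0 : 0 < r by lra.
have he : 0 < mdist z z' / r <= 2 by rewrite divr_gt0//= ler_pdivrMr.
have h2 : 0 <= (2^-1 : R) <= 1 by lra.
have /andP[eta0 _] := modulus_range hM r0 he.
have := @modulus_convexity _ _ _ _ hM r _ x z z' r0 he.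
rewrite !(metric_sym _ x) mulfVK ?gt_eqF// => /(_ xz xz' (lexx _)) mx.
have my := W1 hW z z' y h2.
have := metric_triangle x (W z z' 2^-1) y.
rewrite (metric_sym (W _ _ _)) => tri.
have : 0 < eta r (mdist z z' / r) * r by rewrite mulr_gt0.
have rE : r = l * mdist x y by [].
by lra.
Qed.

(** The axioms of W say nothing about iterated combinations; the identity comes
from uniqueness of the point dividing a segment in a given ratio. *)
Lemma W_midpoint (x y : X) (l : R) : 0 <= l -> l <= 2^-1 ->
  W x y l = W x (W x y 2^-1) (2 * l).
Proof.
move=> l0 l2; have hl : 0 <= l <= 1 by lra.
have h2 : 0 <= (2^-1 : R) <= 1 by lra.
have h2l : 0 <= 2 * l <= 1 by lra.
have xm := mdist_W_l x y h2; have ym := mdist_W_r x y h2.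
apply: (@between_unique x y _ _ l); [exact: mdist_W_l|exact: mdist_W_r| |].
- by apply: le_trans (mdist_W_l _ _ h2l) _; nra.
- have := W1 hW x (W x y 2^-1) y h2l; rewrite (metric_sym y x).
  by move/le_trans; apply; nra.
Qed.

Let uniform_convexity_W_half (r e : R) (a x y : X) (l : R) :
  0 < r -> 0 < e <= 2 -> 0 <= l -> l <= 2^-1 ->
  mdist x a <= r -> mdist y a <= r -> e * r <= mdist x y ->
  mdist (W x y l) a <= (1 - 2 * l * (1 - l) * eta r e) * r.
Proof.
move=> r0 he l0 l2 xa ya xy; rewrite W_midpoint// metric_sym.
have h2l : 0 <= 2 * l <= 1 by lra.
have m := modulus_convexity hM r0 he xa ya xy; rewrite metric_sym in m.
have /andP[eta0 _] := modulus_range hM r0 he.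
apply: le_trans (W1 hW _ _ _ h2l) _; rewrite (metric_sym a x).
apply: (@le_trans _ _ ((1 - 2 * l) * r + 2 * l * ((1 - eta r e) * r))).
  by apply: lerD; apply: ler_wpM2l => //; lra.
have : 0 <= l ^+ 2 * (eta r e * r) by rewrite !mulr_ge0 ?sqr_ge0// ltW.
by lra.
Qed.

(** The modulus speaks of midpoints only.  For l <= 1/2 the point W x y l is a
combination of x and the midpoint with weight 2 l on the latter, so it inherits
the gain with the factor 2 l; (W3) exchanges x and y when l > 1/2. *)
Lemma uniform_convexity_W (r e : R) (a x y : X) (l : R) :
  0 < r -> 0 < e <= 2 -> 0 <= l <= 1 ->
  mdist x a <= r -> mdist y a <= r -> e * r <= mdist x y ->
  mdist (W x y l) a <= (1 - 2 * l * (1 - l) * eta r e) * r.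
Proof.
move=> r0 he /andP[l0 l1] xa ya xy.
have [l2|l2] := leP l 2^-1; first exact: uniform_convexity_W_half.
rewrite (W3 hW); last lra.
have -> : 2 * l * (1 - l) = 2 * (1 - l) * (1 - (1 - l)) by ring.
by rewrite metric_sym in xy; apply: uniform_convexity_W_half => //; lra.
Qed.

End UniformConvexity.

(** * One Ishikawa step *)

Section IshikawaStep.
Context {R : realType} {X : metricType R} (W : X -> X -> R -> X).
Context (C : set X) (T : X -> X) (hW : is_Whyperbolic W) (hC : is_convex W C).
Context (hTC : set_fun C C T) (hT : nonexpansive_on C T).
Context (u : X) (sg l : R) (Cu : C u) (hsg : 0 <= sg <= 1) (hl : 0 <= l <= 1).

Let p := W u (T u) sg.
Let v := W u (T p) l.

Let CTu : C (T u). Proof. exact: hTC. Qed.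
Let Cp : C p. Proof. exact: hC.2. Qed.
Let CTp : C (T p). Proof. exact: hTC. Qed.

Lemma step_mem : C v.
Proof. exact: hC.2. Qed.

Lemma step_gap : (1 - sg) * mdist u (T u) <= mdist u (T p).
Proof.
have := mdist_W_l hW u (T u) hsg; rewrite -/p => up.
have := hT Cp Cu; rewrite (metric_sym p u) => TpTu.
by have := metric_triangle u (T p) (T u); lra.
Qed.

(** Passing through u, d(v, Tv) <= (1 - l) (d(v, u) + d(v, Tv)) + l d(p, v): the
residual of v occurs on both sides, and solving for it costs a division by l. *)
Lemma step_residual :
  mdist v (T v) <= (1 + 2 * (sg * (1 - l))) * mdist u (T u).
Proof.
have [/eqP l0|l0] := boolP (l == 0).
  have uv : mdist u v = 0.
    apply/eqP; rewrite eq_le mdist_ge0 andbT.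
    by apply: le_trans (mdist_W_l hW _ _ hl) _; rewrite l0 mul0r.
  have <- := mdist_positivity _ _ uv; rewrite l0.
  have : 0 <= sg * mdist u (T u).
    by rewrite mulr_ge0 ?mdist_ge0//; case/andP: hsg.
  by lra.
have l_gt0 : 0 < l by rewrite lt_neqAle eq_sym l0; case/andP: hl.
have Cv := step_mem.
have up : mdist p u <= sg * mdist u (T u).
  by rewrite metric_sym; exact: mdist_W_l.
have TpTu := hT Cp Cu; have TpTv := hT Cp Cv.
have pTu : mdist p (T u) <= (1 - sg) * mdist u (T u).
  by rewrite metric_sym; exact: mdist_W_r.
have pTp : mdist p (T p) <= mdist u (T u).
  by have := metric_triangle p (T u) (T p); rewrite (metric_sym (T u)); lra.
have uTp : mdist u (T p) <= (1 + sg) * mdist u (T u).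
  by have := metric_triangle u (T u) (T p); rewrite (metric_sym (T u)); lra.
have pv : mdist p v <= (1 - l) * mdist p u + l * mdist p (T p) by exact: W1.
have uv : mdist u v <= l * mdist u (T p) by exact: mdist_W_l.
have Tvv : mdist (T v) v <= (1 - l) * mdist (T v) u + l * mdist (T v) (T p).
  exact: W1.
have Tvu := metric_triangle (T v) v u.
rewrite (metric_sym (T v) v) in Tvv Tvu.
rewrite (metric_sym (T v) (T p)) in Tvv; rewrite (metric_sym v u) in Tvu.
have /andP[l_ge0 l_le1] := hl; have l' : 0 <= 1 - l by lra.
(* All estimates are scaled so that the bound on l * mdist v (T v) is linear in
   the remaining distances. *)
have h1 := ler_wpM2l l' Tvu.
have h2 := ler_wpM2l l' uv.
have h3 := ler_wpM2l l_ge0 (le_trans TpTv pv).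
have h4 := ler_wpM2l l_ge0 (ler_wpM2l l' up).
have h5 := ler_wpM2l l_ge0 (ler_wpM2l l_ge0 pTp).
have h6 := ler_wpM2l l_ge0 (ler_wpM2l l' uTp).
by rewrite -(ler_pM2l l_gt0); lra.
Qed.

Context (y : X) (Cy : C y).

(** Both d(T p, y) and d(v, y) exceed d(u, y) by at most twice the residual of
y, hence T p and u lie in a common ball about an almost fixed point, as uniform
convexity requires. *)
Lemma step_mdist_T : mdist (T p) y <= mdist u y + 2 * mdist y (T y).
Proof.
have Tpy := metric_triangle (T p) (T y) y.
have py := W1 hW u (T u) y hsg; rewrite -/p in py.
have Tuy := metric_triangle (T u) (T y) y.
have TuTy := hT Cu Cy; have TpTy := hT Cp Cy.
rewrite (metric_sym (T y) y) in Tpy Tuy.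
rewrite (metric_sym y p) (metric_sym y u) (metric_sym y (T u)) in py.
have /andP[sg0 sg1] := hsg.
have : sg * mdist (T u) y <= sg * (mdist u y + mdist y (T y)).
  by apply: ler_wpM2l => //; lra.
have : sg * mdist y (T y) <= mdist y (T y) by rewrite ler_piMl ?mdist_ge0.
by lra.
Qed.

Lemma step_fejer : mdist v y <= mdist u y + 2 * mdist y (T y).
Proof.
have := W1 hW u (T p) y hl; rewrite -/v !(metric_sym y) => vy.
have := step_mdist_T; rewrite !(metric_sym y) => Tpy.
have := mdist_ge0 (T y) y.
have /andP[l0 l1] := hl; have := ler_wpM2l l0 Tpy.
by nra.
Qed.

End IshikawaStep.

(** * Sums and growth of real sequences *)

Section RealSequences.
Context {R : realType}.

Lemma le_sum_increments (f g : nat -> R) (m n : nat) : (m <= n)%N ->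
  (forall k, (m <= k < n)%N -> f k.+1 <= f k + g k) ->
  f n <= f m + \sum_(m <= k < n) g k.
Proof.
move=> mn fg; rewrite -lerBlDl -telescope_sumr//.
by apply: ler_sum_nat => k /fg; rewrite lerBlDl.
Qed.

Lemma le_expR_sum_mul (a t : nat -> R) (m n : nat) : (m <= n)%N ->
  (forall k, 0 <= a k) -> (forall k, a k.+1 <= (1 + t k) * a k) ->
  a n <= expR (\sum_(m <= k < n) t k) * a m.
Proof.
move=> mn a0 at_; elim: n mn => [|n IH].
  by rewrite leqn0 => /eqP ->; rewrite big_geq// expR0 mul1r.
rewrite leq_eqVlt => /predU1P[->|mn]; first by rewrite big_geq// expR0 mul1r.
rewrite big_nat_recr//= expRD [expR _ * _]mulrC -mulrA.
apply: le_trans (at_ n) _; apply: le_trans (ler_wpM2r (a0 n) (expR_ge1Dx _)) _.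
by rewrite ler_wpM2l ?expR_ge0 ?IH.
Qed.

(** Sharp enough for 5/6 * (5/3)^-1 = 1/2, the product of the two losses in the
gap d(x_m, T p_m). *)
Lemma expR_half_le : expR 2^-1 <= 5 / 3 :> R.
Proof.
(* exp(-1/2) = exp(-1/32)^16 >= (31/32)^16 = 0.6017 just exceeds 3/5. *)
have h32 : 31 / 32 <= expR (- 32^-1) :> R.
  by apply: le_trans (expR_ge1Dx _); lra.
have -> : 2^-1 = - (16%:R * - 32^-1) :> R by field.
rewrite expRN expRM_natl -[leRHS]invf_div.
rewrite lef_pV2 ?posrE ?divr_gt0 ?exprn_gt0 ?expR_gt0//.
have : (31 / 32) ^+ 16 <= expR (- 32^-1) ^+ 16 :> R.
  by rewrite lerXn2r// nnegrE ?expR_ge0//; lra.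
by apply: le_trans; lra.
Qed.

Lemma sum_le_quarter (q : nat -> R) (m n : nat) : (forall k, q k <= 4^-1) ->
  \sum_(m <= k < n) q k <= (n - m)%:R / 4.
Proof.
move=> q4; apply: (@le_trans _ _ (\sum_(m <= k < n) 4^-1)).
  by apply: ler_sum.
by rewrite sumr_const_nat mulr_natl.
Qed.

(** Each term is at most 1/4, so dropping the K terms before K and the term of
index M costs at most (K + 1) / 4, which leaves P + 1/2 because K >= 1. *)
Lemma divergence_tail (q : nat -> R) (M P K n : nat) :
  (forall k, 0 <= q k <= 4^-1) -> (0 < K)%N -> (M <= n)%N ->
  (P + K)%:R <= \sum_(0 <= k < M.+1) q k ->
  (K <= n)%N /\ P%:R + 2^-1 <= \sum_(K <= k < n) q k.
Proof.
move=> hq K0 Mn hM.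
have q0 k : 0 <= q k by case/andP: (hq k).
have q4 k : q k <= 4^-1 by case/andP: (hq k).
have hn : (P + K)%:R <= \sum_(0 <= k < n) q k + 4^-1.
  apply: le_trans hM _; rewrite big_nat_recr//= lerD//.
  by rewrite (big_cat_nat (leq0n M) Mn)//= lerDl sumr_ge0.
have K1 : 1 <= K%:R :> R by rewrite ler1n.
have P0 : 0 <= P%:R :> R by exact: ler0n.
rewrite natrD in hn.
have Kn : (K <= n)%N.
  rewrite -(ler_nat R); have := sum_le_quarter 0 n q4; rewrite subn0.
  by lra.
split=> //; have := sum_le_quarter 0 K q4; rewrite subn0.
by move: hn; rewrite (big_cat_nat (leq0n K) Kn)//=; lra.
Qed.

Lemma cauchy_modulus_tail (t : nat -> R) (gamma : R -> nat) (d : R)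
    (K n : nat) :
  (forall k, 0 <= t k) -> cauchy_modulus t gamma -> 0 < d ->
  (gamma d < K)%N -> (K <= n)%N -> \sum_(K <= k < n) t k <= d.
Proof.
move=> t0 ht d0 gK Kn; have gn := leq_trans gK Kn.
have := ht d (n - (gamma d).+1)%N d0; rewrite -addSn subnKC//.
rewrite (big_cat_nat (leq0n _) gn)//= (big_cat_nat gK Kn)//=.
rewrite [X in X - _]addrC addrK.
by apply: le_trans; rewrite lerDr sumr_ge0.
Qed.

End RealSequences.

(** * Residuals and approach to almost fixed points along the iteration *)

Section Ishikawa.
Context {R : realType} {X : metricType R} (W : X -> X -> R -> X).
Context (eta : R -> R -> R) (C : set X) (T : X -> X) (lam s : nat -> R) (x : X).
Context (hX : is_UCWhyperbolic W eta) (hC : is_convex W C).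
Context (hTC : set_fun C C T) (hT : nonexpansive_on C T).
Context (hlam : forall n, 0 <= lam n <= 1) (hs : forall n, 0 <= s n <= 1).
Context (Cx : C x).

Let hW := UCW_hyperbolic hX.
Local Notation xs := (ishikawa W T lam s x).
Local Notation a n := (mdist (xs n) (T (xs n))).

Lemma ishikawa_mem n : C (xs n).
Proof. by elim: n => //= n IH; exact: (step_mem hC hTC IH (hs n) (hlam n)). Qed.

Lemma ishikawa_residual n : a n.+1 <= (1 + 2 * (s n * (1 - lam n))) * a n.
Proof.
exact: (step_residual hW hC hTC hT (ishikawa_mem n) (hs n) (hlam n)).
Qed.

Lemma ishikawa_fejer y m n : C y -> (m <= n)%N ->
  mdist (xs n) y <= mdist (xs m) y + (n - m)%:R * (2 * mdist y (T y)).
Proof.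
move=> Cy mn.
have := @le_sum_increments _ (fun k => mdist (xs k) y)
  (fun=> 2 * mdist y (T y)) m n mn.
rewrite sumr_const_nat -[_ *+ (n - m)]mulr_natl; apply => k _.
exact: (step_fejer hW hC hTC hT (ishikawa_mem k) (hs k) (hlam k) Cy).
Qed.

Lemma residual_le_mdist u y : C u -> C y ->
  mdist u (T u) <= 2 * mdist u y + mdist y (T y).
Proof.
move=> Cu Cy; have := metric_triangle u y (T u).
have := metric_triangle y (T y) (T u); have := hT Cy Cu.
by rewrite (metric_sym y u); lra.
Qed.

Context (b : R) (hb : 0 < b).
Context (hfix : forall delta : R, 0 < delta ->
  exists y : X, [/\ C y, mdist x y <= b & mdist y (T y) < delta]).

Lemma ishikawa_residual_le n : a n <= 2 * b.
Proof.
apply/ler_addgt0Pr => c c0.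
have k0 : 0 < (4 * n%:R + 1 : R) by rewrite ltr_wpDl// mulr_ge0.
have [y [Cy xy yTy]] := hfix (divr_gt0 c0 k0).
have := residual_le_mdist (ishikawa_mem n) Cy.
have := ishikawa_fejer Cy (leq0n n); rewrite subn0 /=.
by move: yTy; rewrite ltr_pdivlMr//; lra.
Qed.

(** The modulus is evaluated at the fixed radius r although the actual ball, of
radius d(x_n, y) + 2 d(y, T y), is smaller: eta is nonincreasing in the radius,
and a gap of e * r is larger than e times the smaller radius. *)
Lemma step_descent (r e : R) (y : X) (n : nat) : C y -> 0 < r -> 0 < e <= 2 ->
  mdist (xs n) y + 2 * mdist y (T y) <= r ->
  e * r <= (1 - s n) * a n ->
  mdist (xs n.+1) y <= (1 - 2 * lam n * (1 - lam n) * eta r e) *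
    (mdist (xs n) y + 2 * mdist y (T y)).
Proof.
move=> Cy r0 he hr gap.
have Cn := ishikawa_mem n.
set rho := mdist (xs n) y + _ in hr *.
have ur : mdist (xs n) y <= rho by rewrite lerDl mulr_ge0 ?mdist_ge0.
have Tr := step_mdist_T hW hC hTC hT Cn (hs n) Cy; rewrite -/rho in Tr.
have D := step_gap hW hC hTC hT Cn (hs n).
have e0 : 0 < e by case/andP: he.
have er : e * rho <= e * r by rewrite ler_pM2l.
have rho0 : 0 < rho.
  have := metric_triangle (xs n) y (T (W (xs n) (T (xs n)) (s n))).
  rewrite (metric_sym y) => tri.
  have : 0 < e * r by rewrite mulr_gt0.
  by lra.
have gap' := le_trans er (le_trans gap D).
apply: le_trans
  (uniform_convexity_W hW (UCW_modulus hX) rho0 he (hlam n) ur Tr gap') _.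
have /andP[l0 l1] := hlam n.
rewrite ler_pM2r// lerD2l lerN2 ler_wpM2l ?(UCW_nonincreasing hX)//.
by rewrite !mulr_ge0// subr_ge0.
Qed.

(** The distance to an almost fixed point starts at no more than b, ends at no
less than d / 2 because a n <= 2 * mdist (xs n) y up to d(y, T y), and each
good step takes off eta (b + 1) e * d times lam m * (1 - lam m).  All errors
are multiples of d(y, T y), with factors depending on the fixed n only. *)
Lemma ishikawa_descent (e d : R) (K n : nat) (good : pred nat) :
  (K <= n)%N -> 0 < e <= 2 -> 0 < d -> d <= a n ->
  (forall m, (K <= m < n)%N -> good m -> e * (b + 1) <= (1 - s m) * a m) ->
  d / 2 + eta (b + 1) e * d *
    (\sum_(K <= m < n | good m) lam m * (1 - lam m)) <= b.
Proof.
move=> Kn he d0 dn hgood.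
set h := eta (b + 1) e; set S := \sum_(_ <= _ < _ | _) _.
have b1 : 0 < b + 1 by rewrite addr_gt0.
have /andP[h0 h1] : 0 < h <= 1 := modulus_range (UCW_modulus hX) b1 he.
pose N : R := n%:R; have N0 : 0 <= N by exact: ler0n.
apply/ler_addgt0Pr => c c0.
(* Each step loses at most (4 N + 3) * dl; bounding dl by (2 N + 1)^-1 keeps the
   balls of the first n steps within radius b + 1. *)
have k0 : 0 < N * (4 * N + 3) + 1 by rewrite ltr_wpDl// mulr_ge0//; lra.
have k1 : 0 < 2 * N + 1 by lra.
have [|y [Cy xy yTy]] := hfix
  (delta := Num.min (c / (N * (4 * N + 3) + 1)) (2 * N + 1)^-1).
  by rewrite lt_min divr_gt0//= invr_gt0.
move: yTy; rewrite lt_min -[(2 * N + 1)^-1]mul1r !ltr_pdivlMr//.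
move=> /andP[yTy1 yTy2].
set dl := mdist y (T y) in yTy1 yTy2; have dl0 : 0 <= dl by exact: mdist_ge0.
pose rho m := mdist (xs m) y.
have rho_end m : (m <= n)%N -> d <= 2 * rho m + dl + 4 * N * dl.
  move=> mn; have := residual_le_mdist (ishikawa_mem n) Cy.
  have := ishikawa_fejer Cy mn; rewrite -/dl -/(rho m) -/(rho n).
  have : (n - m)%:R * dl <= N * dl by rewrite ler_wpM2r// ler_nat leq_subr.
  by lra.
have rho_start m : (m <= n)%N -> rho m <= b + 2 * m%:R * dl.
  move=> mn; have := ishikawa_fejer Cy (leq0n m).
  by rewrite subn0 /= -/dl -/(rho m); lra.
have step m : (K <= m < n)%N -> rho m.+1 <= rho m +
    ((4 * N + 3) * dl - (if good m then h * d * (lam m * (1 - lam m)) else 0)).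
  move=> /andP[Km mn]; have /andP[l0 l1] := hlam m.
  have := ishikawa_fejer Cy (leqnSn m).
  rewrite subSnn mul1r -/dl -/(rho m) -/(rho m.+1) => fejer.
  have Ndl : 0 <= N * dl by rewrite mulr_ge0.
  case: ifPn => [gm|_]; last by lra.
  have hr : rho m + 2 * dl <= b + 1.
    have := rho_start m (ltnW mn).
    have : m.+1%:R * dl <= N * dl by rewrite ler_wpM2r// ler_nat.
    by rewrite -natr1; lra.
  have := step_descent Cy b1 he hr (hgood m _ gm); rewrite Km mn => /(_ isT).
  rewrite -/dl -/(rho m) -/(rho m.+1) -/h => desc.
  set q := lam m * (1 - lam m) in desc *.
  have q0 : 0 <= q by rewrite mulr_ge0// subr_ge0.
  have q1 : q <= 1 by rewrite /q; nra.
  have qh0 : 0 <= q * h by rewrite mulr_ge0// ltW.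
  have qh1 : q * h <= 1 by rewrite mulr_ile1// ltW.
  have qE : 2 * lam m * (1 - lam m) * h = 2 * (q * h) by rewrite /q; ring.
  rewrite qE in desc.
  (* The lower bound on rho m turns the relative gain 2 q h into q h d. *)
  have h3 := ler_wpM2l qh0 (rho_end m (ltnW mn)).
  have h4 : (q * h) * (dl + 4 * N * dl) <= dl + 4 * N * dl.
    by rewrite ler_piMl//; lra.
  have h5 : 0 <= (q * h) * dl by rewrite mulr_ge0.
  by lra.
have := le_sum_increments Kn step.
rewrite big_split/= sumrN sumr_const_nat -big_mkcond/= -mulr_sumr -/S => tot.
have totn : ((4 * N + 3) * dl) *+ (n - K) = (n - K)%:R * (4 * N + 3) * dl.
  by rewrite -[LHS]mulr_natl mulrA.
rewrite totn natrB// -/N in tot.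
have := rho_end n (leqnn n); have := rho_start K Kn.
have KN : K%:R <= N by rewrite ler_nat.
have KNdl : 0 <= K%:R * (N * dl) by rewrite !mulr_ge0.
have KNd : 0 <= K%:R * dl by rewrite !mulr_ge0.
have := residual_le_mdist (ishikawa_mem n) Cy; rewrite -/dl -/(rho n).
by lra.
Qed.

End Ishikawa.

(** * The rate of asymptotic regularity *)

Lemma P_bound_ge {R : realType} (e : R) (eta : R -> R -> R) (b : R) (L : nat) :
  0 < e -> 0 < L%:R * (b + 1) -> 0 < eta (b + 1) (e / (L%:R * (b + 1))) ->
  L%:R * (b + 1) <=
    e * eta (b + 1) (e / (L%:R * (b + 1))) * (P_bound e eta b L)%:R.
Proof.
move=> e0 Lb h0; rewrite [leRHS]mulrC -ler_pdivrMr ?mulr_gt0//.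
rewrite /P_bound natr_absz ger0_norm ?ceil_ge// ceil_ge0.
by rewrite (lt_trans (ltrN10 _))// divr_gt0// mulr_gt0.
Qed.

Section Rate.
Context {R : realType} {X : metricType R} (W : X -> X -> R -> X).
Context (eta : R -> R -> R) (C : set X) (T : X -> X) (lam s : nat -> R) (x : X).
Context (hX : is_UCWhyperbolic W eta) (hC : is_convex W C).
Context (hTC : set_fun C C T) (hT : nonexpansive_on C T).
Context (hlam : forall n, 0 <= lam n <= 1) (hs : forall n, 0 <= s n <= 1).
Context (theta : nat -> nat) (L N0 : nat) (gamma : R -> nat) (b : R).
Context (htheta : rate_of_divergence (fun n => lam n * (1 - lam n)) theta).
Context (hL : (1 <= L)%N).
Context (hN0 : forall n : nat, (N0 <= n)%N -> s n <= 1 - L%:R^-1).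
Context (hgamma : cauchy_modulus (fun n => s n * (1 - lam n)) gamma).
Context (Cx : C x) (hb : 0 < b).
Context (hfix : forall delta : R, 0 < delta ->
  exists y : X, [/\ C y, mdist x y <= b & mdist y (T y) < delta]).

Local Notation xs := (ishikawa W T lam s x).
Local Notation a n := (mdist (xs n) (T (xs n))).

Lemma ishikawa_rate (e : R) (n : nat) : 0 < e ->
  (Phi e eta b N0 L theta gamma <= n)%N -> a n < e.
Proof.
move=> e0 hn; rewrite ltNge; apply/negP => en.
have e2b : e <= 2 * b.
  apply: le_trans en _.
  exact: (ishikawa_residual_le hX hC hTC hT hlam hs Cx hfix).
pose q k := lam k * (1 - lam k); pose t k := s k * (1 - lam k).
have lam0 k : 0 <= lam k by case/andP: (hlam k).
have lam1 k : 0 <= 1 - lam k by rewrite subr_ge0; case/andP: (hlam k).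
have s0 k : 0 <= s k by case/andP: (hs k).
have t0 k : 0 <= t k by rewrite mulr_ge0.
have q0 k : 0 <= q k by rewrite mulr_ge0.
have hq k : 0 <= q k <= 4^-1.
  by rewrite q0 /q; have := sqr_ge0 (lam k - 2^-1); lra.
set P := P_bound e eta b L; pose K := ((gamma (e / (8 * b))%R).+1 + N0)%N.
have [||Kn hS] := @divergence_tail _ q _ P K n hq _ hn.
- by rewrite /K.
- have -> : (P + K = P + gamma (e / (8 * b))%R + 1 + N0)%N by rewrite /K; lia.
  exact: htheta.
have gK : (gamma (e / (8 * b)) < K)%N by rewrite /K leq_addr.
have b8 : 0 < 8 * b by rewrite mulr_gt0.
have hA : \sum_(K <= k < n) t k <= e / (8 * b).
  by apply: (cauchy_modulus_tail _ hgamma) => //; rewrite divr_gt0.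
have hA4 : \sum_(K <= k < n) t k <= 4^-1.
  by apply: le_trans hA _; rewrite ler_pdivrMr//; lra.
have L1 : 1 <= L%:R :> R by rewrite ler1n.
have L0 : 0 < L%:R :> R by rewrite ltr0n.
have Lb : 0 < L%:R * (b + 1) by rewrite mulr_gt0// addr_gt0.
pose e' := e / (L%:R * (b + 1)).
have he' : 0 < e' <= 2.
  rewrite divr_gt0//= ler_pdivrMr//.
  have : b + 1 <= L%:R * (b + 1) by rewrite ler_peMl// addr_ge0// ltW.
  by lra.
have e'b : e' * (b + 1) = e / L%:R.
  by rewrite /e'; field; rewrite !gt_eqF// addr_gt0.
set h := eta (b + 1) e'.
have /andP[h0 h1] : 0 < h <= 1.
  by apply: (modulus_range (UCW_modulus hX)) => //; rewrite addr_gt0.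
have hP : L%:R * (b + 1) <= h * e * P%:R.
  by rewrite (mulrC h); apply: P_bound_ge; rewrite // addr_gt0.
have hA0 m : (K <= m < n)%N -> \sum_(m <= k < n) t k <= \sum_(K <= k < n) t k.
  move=> /andP[Km mn].
  by rewrite (big_cat_nat Km (ltnW mn))//= lerDr sumr_ge0.
have growth m : (m <= n)%N -> e <= expR (2 * \sum_(m <= k < n) t k) * a m.
  move=> mn; apply: le_trans en _; rewrite mulr_sumr.
  apply: (@le_expR_sum_mul _ (fun k => a k) (fun k => 2 * t k)) => // k.
    exact: mdist_ge0.
  exact: (ishikawa_residual hX hC hTC hT hlam hs Cx).
have descent good := ishikawa_descent hX hC hTC hT hlam hs Cx hb hfix
  (good := good) Kn he' e0 en.
(* For L = 1 the parameters s_k vanish from N0 on and no step is lost. *)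
have [LE|L2] := leqP L 1.
  have {}LE : L = 1%N by apply/anti_leq; rewrite LE.
  have all_good m : (K <= m < n)%N -> xpredT m ->
      e' * (b + 1) <= (1 - s m) * a m.
    move=> /andP[Km mn] _; rewrite e'b LE invr1 mulr1.
    have sm k : (K <= k)%N -> s k = 0.
      move=> Kk; apply/eqP; rewrite eq_le s0 andbT.
      have := hN0 (leq_trans (leq_addl _ _) Kk).
      by rewrite LE invr1 subrr.
    have := growth _ (ltnW mn); rewrite sm// subr0 mul1r.
    rewrite big1_seq ?mulr0 ?expR0 ?mul1r// => k /andP[_].
    rewrite mem_index_iota => /andP[mk _].
    by rewrite /t sm ?mul0r// (leq_trans Km).
  have := descent _ all_good; rewrite -/h.
  have : h * e * (P%:R + 2^-1) <= h * e * \sum_(K <= k < n) q k.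
    by rewrite ler_pM2l// mulr_gt0.
  have : 0 < h * e by rewrite mulr_gt0.
  by rewrite LE mul1r in hP; lra.
have {}L2 : 2 <= L%:R :> R by rewrite ler_nat.
have small_good m : (K <= m < n)%N -> s m <= 6^-1 ->
    e' * (b + 1) <= (1 - s m) * a m.
  move=> Kmn sm; rewrite e'b.
  have mn : (m <= n)%N by case/andP: Kmn => _ /ltnW.
  have am : e <= 5 / 3 * a m.
    apply: le_trans (growth _ mn) _; rewrite ler_wpM2r ?mdist_ge0//.
    apply: le_trans _ expR_half_le; rewrite ler_expR.
    by have := le_trans (hA0 _ Kmn) hA4; lra.
  rewrite ler_pdivrMr//.
  have a0 : 0 <= a m by exact: mdist_ge0.
  have : 5 / 6 * a m <= (1 - s m) * a m by rewrite ler_wpM2r//; lra.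
  have : 0 <= (1 - s m) * a m by rewrite mulr_ge0// subr_ge0; lra.
  by nra.
(* Where s k > 1/6, the term lam k * (1 - lam k) is controlled by 6 * t k. *)
have bad : \sum_(K <= k < n | ~~ (s k <= 6^-1)) q k <= 3 / 2.
  apply: (@le_trans _ _ (\sum_(K <= k < n) 6 * t k)); last first.
    by rewrite -mulr_sumr; lra.
  rewrite big_mkcond/=; apply: ler_sum => k _.
  case: ifPn => [|_]; last by rewrite mulr_ge0.
  rewrite -ltNge /q /t => sk.
  have := lam1 k; have := lam0 k; nra.
(* S >= P + 1/2 - 3/2, and h * e * (P - 1) >= 2 (b + 1) - e > b - e / 2 because
   h <= 1 and e <= 2 b. *)
have := hS; rewrite (bigID (fun k => s k <= 6^-1))/= => hS'.
have := descent (fun k => s k <= 6^-1) small_good; rewrite -/h.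
set S := \sum_(_ <= _ < _ | s _ <= _) _ in hS' *.
have : h * e * (P%:R - 1) <= h * e * S.
  by rewrite ler_pM2l ?mulr_gt0//; lra.
have : h * e <= e by rewrite ler_piMl// ltW.
have : 2 * (b + 1) <= L%:R * (b + 1) by rewrite ler_pM2r// addr_gt0.
by lra.
Qed.

End Rate.

Theorem theorem4p1 (R : realType) (X : metricType R) (W : X -> X -> R -> X)
    (eta : R -> R -> R) (C : set X) (T : X -> X) (lam s : nat -> R)
    (theta : nat -> nat) (L N0 : nat) (gamma : R -> nat) (x : X) (b : R)
    (hX : is_UCWhyperbolic W eta)
    (heta : out_of_range_convention eta)
    (hC : is_convex W C)
    (hTC : set_fun C C T)
    (hT : nonexpansive_on C T)
    (hlam : forall n : nat, 0 <= lam n <= 1)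
    (hs : forall n : nat, 0 <= s n <= 1)
    (hdiv : series (fun n => lam n * (1 - lam n)) @ \oo --> +oo)
    (htheta : rate_of_divergence (fun n => lam n * (1 - lam n)) theta)
    (hlimsup : limn_sup s < 1)
    (hL : (1 <= L)%N)
    (hN0 : forall n : nat, (N0 <= n)%N -> s n <= 1 - L%:R^-1)
    (hcvg : cvgn (series (fun n => s n * (1 - lam n))))
    (hgamma : cauchy_modulus (fun n => s n * (1 - lam n)) gamma)
    (hx : C x)
    (hb : 0 < b)
    (hfix : forall delta : R, 0 < delta ->
      exists y : X, [/\ C y, mdist x y <= b & mdist y (T y) < delta]) :
  let xs := ishikawa W T lam s x in
  ((fun n : nat => mdist (xs n) (T (xs n))) @ \oo --> (0 : R)) /\
  (forall (e : R) (n : nat), 0 < e ->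
     (Phi e eta b N0 L theta gamma <= n)%N ->
     mdist (xs n) (T (xs n)) < e).
Proof.
have rate := ishikawa_rate hX hC hTC hT hlam hs htheta hL hN0 hgamma hx hb hfix.
split; last exact: rate.
apply/cvgr0Pnorm_lt => e e0.
near=> n; rewrite ger0_norm ?mdist_ge0//; apply: rate => //.
by near: n; exact: nbhs_infty_ge.
Unshelve. all: by end_near.
Qed.
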